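(* Let $n,m\ge1$, let $w=w_1\cdots w_n\in W_{n,m}$ be a word of length $n$ in the alphabet $[m]=\{1,\ldots,m\}$, and let $\pi=\Phi^{-1}(D(w))$. Then the shape of $\pi$ is $(L_m(w),L_{m-1}(w),\ldots,L_1(w))$ (trailing zeros being allowed).
   Context: A plane partition $\pi=(\pi_{ij})_{i,j\ge1}$ is a two-dimensional array of nonnegative integers with finitely many nonzero entries such that $\pi_{ij}\ge\pi_{i+1\,j}$ and $\pi_{ij}\ge\pi_{i\,j+1}$ for all $i,j$ ($i$ is the row index, $j$ the column index); its shape is the partition whose Young diagram is $\{(i,j):\pi_{ij}>0\}$, i.e. the sequence of numbers of nonzero entries in the rows. $\Phi$ is the map sending a plane partition $\pi$ with at most $m$ nonzero rows and all entries at most $n$ to the $m\times n$ matrix $(d_{i\ell})_{1\le i\le m,\,1\le\ell\le n}$ of nonnegative integers with $d_{i\ell}=|\{j:\pi_{ij}=\ell>\pi_{i+1\,j}\}|$. This map is a bijection from the set of such plane partitions (with no restriction on the number of columns) onto the set of $m\times n$ matrices of nonnegative integers; $\Phi^{-1}$ is its inverse. For a word $w=w_1\cdots w_n\in W_{n,m}$, $D(w)=(d_{ij})$ is the $m\times n$ $01$-matrix with $d_{w_i,i}=1$ for all $i\in[n]$ and all other entries zero. A weakly increasing subsequence of $w$ is a sequence $w_{i_1}\le\cdots\le w_{i_k}$ with $1\le i_1<\cdots<i_k\le n$; $k$ is its length. $L_i(w)$ is the maximal length of a weakly increasing subsequence of $w$ all of whose letters belong to $\{m-i+1,\ldots,m\}$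 (equal to $0$ if no such letters occur in $w$). *)

(* Defs.v *)
From HB Require Import structures.
From Stdlib Require Import ClassicalEpsilon.
From mathcomp Require Import all_boot all_order all_algebra.
From mathcomp Require Import finmap zify.

Set Implicit Arguments.
Unset Strict Implicit.
Unset Printing Implicit Defensive.

Local Open Scope fset_scope.
Local Open Scope nat_scope.

(* Rows and columns are numbered from 0 and a letter a : 'I_m or a matrix
   index l : 'I_n stands for the positive integer a.+1, l.+1.  The entries of
   an array are not shifted. *)

Definition array := {fsfun nat * nat -> nat with 0}.

Definition plane_partition (pi : array) : Prop :=
  forall i j, pi (i.+1, j) <= pi (i, j) /\ pi (i, j.+1) <= pi (i, j).

Definition bounded_pp (m n : nat) (pi : array) : Prop :=
  [/\ plane_partition pi,
      forall i j, m <= i -> pi (i, j) = 0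
    & forall i j, pi (i, j) <= n].

Definition row_support (pi : array) (i : nat) : {fset nat} :=
  [fset p.2 | p in finsupp pi & p.1 == i].

(* The shape is an infinite sequence, eventually 0. *)
Definition pp_shape (pi : array) (i : nat) : nat := #|` row_support pi i|.

(* Since l.+1 > 0, restricting j to the support of row i loses nothing. *)
Definition Phi (m n : nat) (pi : array) : 'M[nat]_(m, n) :=
  \matrix_(i < m, l < n)
    #|` [fset j in row_support pi i |
          (pi (val i, j) == l.+1) && (pi (i.+1, j) < l.+1)]|.

Definition word_mx (n m : nat) (w : n.-tuple 'I_m) : 'M[nat]_(m, n) :=
  \matrix_(a < m, i < n) (tnth w i == a : nat).

(* S is the set of positions of a weakly increasing subsequence of w. *)
Definition weakly_increasing (n m : nat) (w : n.-tuple 'I_m) (S : {set 'I_n}) :=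
  [forall i in S, forall j in S, (i <= j) ==> (tnth w i <= tnth w j)].

(* The letters m-k+1, ..., m are the a : 'I_m with m - k <= a. *)
Definition L (n m : nat) (w : n.-tuple 'I_m) (k : nat) : nat :=
  \max_(S : {set 'I_n} |
      weakly_increasing w S && [forall i in S, m - k <= tnth w i]) #|S|.

Lemma in_row_support (pi : array) i j :
  (j \in row_support pi i) = (pi (i, j) != 0).
Proof.
apply/imfsetP/idP => [[[a b] /=]|nz].
  by rewrite !inE /= mem_finsupp => /andP[h /eqP<-] ->.
by exists (i, j); rewrite //= !inE /= mem_finsupp nz eqxx.
Qed.

Lemma pp_mono (pi : array) : plane_partition pi ->
  forall i j i' j', i <= i' -> j <= j' -> pi (i', j') <= pi (i, j).
Proof.
move=> pp i j i' j' /subnKC <- /subnKC <-.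
move: (i' - i) (j' - j) => a b.
apply: (@leq_trans (pi (i, j + b))).
  by elim: a => [|a IH]; rewrite ?addn0 // addnS (leq_trans (pp _ _).1).
by elim: b => [|b IH]; rewrite ?addn0 // addnS (leq_trans (pp _ _).2).
Qed.

Lemma card_fset_interval (A : {fset nat}) a b :
  (forall j, (j \in A) = (a <= j < b)) -> #|` A| = b - a.
Proof.
move=> AE; have -> : A = [fset j in iota a (b - a)].
  by apply/fsetP => j; rewrite AE !inE /= mem_iota; apply/idP/idP; lia.
by rewrite card_fseq undup_id ?iota_uniq // size_iota.
Qed.

Lemma card_fset_down (A : {fset nat}) :
  (forall j k, j <= k -> k \in A -> j \in A) ->
  forall j, (j \in A) = (j < #|` A|).
Proof.
move=> down.
have ex : exists k, k \notin A.
  exists (\max_(j <- A) j).+1; apply/negP => h.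
  have := @leq_bigmax_seq _ (enum_fset A) xpredT id _ h isT.
  by rewrite ltnn.
case: (ex_minnP ex) => N NA Nmin.
have AE j : (j \in A) = (0 <= j < N).
  apply/idP/idP => /= [jA|jN].
    by rewrite ltnNge; apply/negP => Nj; rewrite (down _ _ Nj jA) in NA.
  by apply: contraLR jN => /Nmin; rewrite leqNgt.
by move=> j; rewrite AE (card_fset_interval AE) subn0.
Qed.

Lemma mem_pp_shape (pi : array) i j :
  plane_partition pi -> (j < pp_shape pi i) = (0 < pi (i, j)).
Proof.
move=> pp; rewrite /pp_shape -card_fset_down ?in_row_support ?lt0n //.
move=> a b ab; rewrite !in_row_support -!lt0n => h.
exact: leq_trans h (pp_mono pp _ ab).
Qed.

Definition row_count (pi : array) i k :=
  #|` [fset j in row_support pi i | k < pi (i, j)]|.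

Lemma lt_row_count (pi : array) i k j :
  plane_partition pi -> (j < row_count pi i k) = (k < pi (i, j)).
Proof.
move=> pp.
have memE c : (c \in [fset j in row_support pi i | k < pi (i, j)]) =
    (k < pi (i, c)).
  rewrite !inE /= in_row_support -lt0n.
  by case: (ltnP k) => h; rewrite ?andbF ?andbT // (leq_ltn_trans _ h).
rewrite /row_count -card_fset_down ?memE // => a b ab.
by rewrite !memE => h; exact: leq_trans h (pp_mono pp _ ab).
Qed.

Lemma row_count_rec m n (pi : array) (i : 'I_m) (l : 'I_n) :
  plane_partition pi ->
  row_count pi i l =
  Phi m n pi i l + maxn (row_count pi i l.+1) (row_count pi i.+1 l).
Proof.
move=> pp; rewrite mxE (@card_fset_interval _
  (maxn (row_count pi i l.+1) (row_count pi i.+1 l)) (row_count pi i l)).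
  rewrite subnK // geq_max; apply/andP; split; rewrite leqNgt;
    apply/negP; rewrite lt_row_count // => h.
    by move: (ltnW h); rewrite -lt_row_count ?ltnn.
  have := leq_trans h (pp_mono pp (leqnSn i) (leqnn _)).
  by rewrite -lt_row_count ?ltnn.
move=> j; rewrite !inE /= in_row_support geq_max.
rewrite !(leqNgt (row_count _ _ _)) !lt_row_count //=.
by move: (pi (nat_of_ord i, j)) (pi (i.+1, j)) => x y; apply/idP/idP; lia.
Qed.

Lemma Phi_inj m n (pi pi' : array) :
  bounded_pp m n pi -> bounded_pp m n pi' ->
  Phi m n pi = Phi m n pi' -> pi = pi'.
Proof.
move=> [pp rows ents] [pp' rows' ents'] E.
have oob (p : array) i k : bounded_pp m n p -> (m <= i) || (n <= k) ->
    row_count p i k = 0.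
  move=> [q r e] h; apply/eqP; rewrite -leqn0 leqNgt lt_row_count // -leqNgt.
  by case/orP: h => h; [rewrite r | apply: leq_trans h].
have cE : forall a b i k, m - i <= a -> n - k <= b ->
    row_count pi i k = row_count pi' i k.
  have base i k : (m <= i) || (n <= k) ->
      row_count pi i k = row_count pi' i k by move=> h; rewrite !oob.
  elim=> [|a IHa]; first by move=> b i k; rewrite leqn0 subn_eq0 => h _; rewrite base ?h.
  elim=> [|b IHb] i k ha hb.
    by move: hb; rewrite leqn0 subn_eq0 => h; rewrite base ?h ?orbT.
  case: (leqP m i) => [|im]; first by move=> h; rewrite base ?h.
  case: (leqP n k) => [|kn]; first by move=> h; rewrite base ?h ?orbT.
  rewrite (row_count_rec (Ordinal im) (Ordinal kn) pp).
  rewrite (row_count_rec (Ordinal im) (Ordinal kn) pp') E /=.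
  rewrite IHb ?(IHa b.+1) //.
  - by rewrite subnS -subn1 leq_subLR add1n.
  - by rewrite subnS -subn1 leq_subLR add1n.
apply/fsfunP => -[i j].
have ltE k : (k < pi (i, j)) = (k < pi' (i, j)).
  by rewrite -!lt_row_count // (cE m n) ?leq_subr.
apply/eqP; rewrite eqn_leq !(leqNgt (_ (i, j))).
by rewrite ltE ltnn -ltE ltnn.
Qed.

Definition mx_entry m n (M : 'M[nat]_(m, n)) (i k : nat) : nat :=
  if insub i is Some i' then if insub k is Some k' then M i' k' else 0 else 0.

Fixpoint last_passage m n (M : 'M[nat]_(m, n)) (a : nat) : nat -> nat :=
  if a isn't a'.+1 then fun=> 0 else
  fix inner b := if b isn't b'.+1 then 0 else
    mx_entry M (m - a) (n - b) + maxn (inner b') (last_passage M a' b).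

Definition lpt m n (M : 'M[nat]_(m, n)) i k := last_passage M (m - i) (n - k).

Lemma lpt_out m n (M : 'M[nat]_(m, n)) i k :
  (m <= i) || (n <= k) -> lpt M i k = 0.
Proof.
by rewrite /lpt -!subn_eq0 => /orP[]/eqP->; last by case: (m - i).
Qed.

Lemma lpt_rec m n (M : 'M[nat]_(m, n)) (i : 'I_m) (k : 'I_n) :
  lpt M i k = M i k + maxn (lpt M i k.+1) (lpt M i.+1 k).
Proof.
rewrite /lpt.
have -> : m - i = (m - i.+1).+1 by rewrite subnSK.
have -> : n - k = (n - k.+1).+1 by rewrite subnSK.
by rewrite /= !subnSK // !subKn 1?ltnW // /mx_entry !valK.
Qed.

Lemma lpt_max m n (M : 'M[nat]_(m, n)) i k :
  maxn (lpt M i k.+1) (lpt M i.+1 k) <= lpt M i k.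
Proof.
case: (leqP m i) => im; first by rewrite !lpt_out // ?im ?(leq_trans im).
case: (leqP n k) => kn.
  by rewrite !lpt_out // ?kn ?(leq_trans kn) ?orbT.
by rewrite (lpt_rec M (Ordinal im) (Ordinal kn)) leq_addl.
Qed.

Lemma lpt_mono m n (M : 'M[nat]_(m, n)) i k i' k' :
  i <= i' -> k <= k' -> lpt M i' k' <= lpt M i k.
Proof.
move=> /subnKC <- /subnKC <-; move: (i' - i) (k' - k) => a b.
apply: (@leq_trans (lpt M i (k + b))).
  elim: a => [|a IH]; rewrite ?addn0 // addnS (leq_trans _ IH) //.
  exact: leq_trans (leq_maxr _ _) (lpt_max _ _ _).
elim: b => [|b IH]; rewrite ?addn0 // addnS (leq_trans _ IH) //.
exact: leq_trans (leq_maxl _ _) (lpt_max _ _ _).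
Qed.

Definition lpt_entry m n (M : 'M[nat]_(m, n)) (p : nat * nat) : nat :=
  #|` [fset k in iota 0 n | p.2 < lpt M p.1 k]|.

Lemma lt_lpt_entry m n (M : 'M[nat]_(m, n)) i j k :
  (k < lpt_entry M (i, j)) = (j < lpt M i k).
Proof.
have AE c : (c \in [fset k in iota 0 n | j < lpt M i k]) = (j < lpt M i c).
  rewrite !inE /= mem_iota /= add0n.
  by case: (ltnP c n) => //= h; rewrite lpt_out ?h ?orbT.
rewrite /lpt_entry /= -card_fset_down ?AE // => a b ab.
by rewrite !AE => h; exact: leq_trans h (lpt_mono M _ ab).
Qed.

Definition lpt_array m n (M : 'M[nat]_(m, n)) : array :=
  [fsfun p in [fset ((i, j) : nat * nat) | i in iota 0 m, j in iota 0 (lpt M 0 0)]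
     => lpt_entry M p].

Lemma lt_lpt_array m n (M : 'M[nat]_(m, n)) i j k :
  (k < lpt_array M (i, j)) = (j < lpt M i k).
Proof.
rewrite /lpt_array fsfunE; case: ifPn => [_|]; first exact: lt_lpt_entry.
move=> nin; rewrite ltn0; apply/esym/negbTE; apply: contra nin => h.
apply/imfset2P; exists i => /=.
  rewrite mem_iota /= add0n ltnNge; apply/negP => mi.
  by rewrite lpt_out ?mi in h.
exists j => //=.
by rewrite mem_iota add0n /= (leq_trans h) // lpt_mono.
Qed.

Lemma leq_ltnE a b : (forall k, k < a -> k < b) -> a <= b.
Proof. by case: a => // a; apply. Qed.

Lemma Phi_surj m n (M : 'M[nat]_(m, n)) :
  exists pi, bounded_pp m n pi /\ Phi m n pi = M.
Proof.
exists (lpt_array M).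
have pp : plane_partition (lpt_array M).
  move=> i j; split; apply: leq_ltnE => k; rewrite !lt_lpt_array => h.
    by rewrite (leq_trans h) // lpt_mono.
  exact: ltnW.
split.
  split=> // i j; last first.
    by rewrite leqNgt lt_lpt_array lpt_out // leqnn orbT.
  by move=> mi; apply/eqP; rewrite -leqn0 leqNgt lt_lpt_array lpt_out ?mi.
have cE i k : row_count (lpt_array M) i k = lpt M i k.
  by apply/eqP; rewrite eqn_leq; apply/andP; split; apply: leq_ltnE => j;
    rewrite lt_row_count // lt_lpt_array.
apply/matrixP => i l; have := row_count_rec i l pp.
by rewrite !cE lpt_rec => /addIn.
Qed.

(* By [Phi_inj] and [Phi_surj], Phi m n is a bijection from the arrays
   satisfying [bounded_pp m n] onto the matrices; this is its inverse. *)
Definition Phi_inv (m n : nat) (M : 'M[nat]_(m, n)) : array :=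
  proj1_sig (constructive_indefinite_description _ (Phi_surj M)).

Lemma Phi_inv_bounded m n (M : 'M[nat]_(m, n)) : bounded_pp m n (Phi_inv M).
Proof. by rewrite /Phi_inv; case: constructive_indefinite_description => ? []. Qed.

Lemma Phi_invK m n : cancel (@Phi_inv m n) (Phi m n).
Proof.
by move=> M; rewrite /Phi_inv; case: constructive_indefinite_description => ? [].
Qed.

Lemma PhiK m n pi : bounded_pp m n pi -> Phi_inv (Phi m n pi) = pi.
Proof.
by move=> b; apply: (Phi_inj (Phi_inv_bounded _) b); rewrite Phi_invK.
Qed.

(* Main.v *)
(* For pi = Phi^{-1}(D(w)), let c(i,k) be the number of entries > k in row i of
   pi.  These numbers satisfy the last-passage recurrence
   c(i,k) = D(w)_{ik} + max(c(i,k+1), c(i+1,k)), and so does the maximal length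
   of a weakly increasing subsequence of w with letters >= i and positions
   >= k: such a subsequence either skips position k, or starts there with
   letter i, or starts there with a larger letter and then never uses i.
   Taking k = 0 gives the shape. *)

Require Import Defs.
From HB Require Import structures.
From mathcomp Require Import all_boot all_order all_algebra.
From mathcomp Require Import finmap.
From mathcomp Require Import zify.
Local Open Scope nat_scope.

Lemma pp_shape_row_count (pi : array) i : pp_shape pi i = row_count pi i 0.
Proof.
congr #|` _|; apply/fsetP => j.
by rewrite !inE /= in_row_support -lt0n andbb.
Qed.

Lemma row_count_out m n (pi : array) i k :
  bounded_pp m n pi -> (m <= i) || (n <= k) -> row_count pi i k = 0.
Proof.
move=> [pp rows ents] out; apply/eqP; rewrite -leqn0 leqNgt lt_row_count //.
by rewrite -leqNgt; case/orP: out => h; [rewrite rows | apply: leq_trans h].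
Qed.

Section Chains.

Variables (n m : nat) (w : n.-tuple 'I_m).

Definition chain_from (i k : nat) (S : {set 'I_n}) :=
  weakly_increasing w S /\ forall p, p \in S -> i <= tnth w p /\ k <= p.

Lemma weakly_increasingP (S : {set 'I_n}) :
  reflect (forall p q, p \in S -> q \in S -> p <= q -> tnth w p <= tnth w q)
          (weakly_increasing w S).
Proof.
apply: (iffP 'forall_in_forall_inP) => h p.
  by move=> q Sp Sq; apply/implyP; exact: h.
by move=> Sp q Sq; apply/implyP; exact: h.
Qed.

Lemma chain_from_skip i (p : 'I_n) (S : {set 'I_n}) :
  chain_from i p S -> p \notin S -> chain_from i p.+1 S.
Proof.
move=> [winc bnd] pS; split=> // q Sq; have [-> leq_pq] := bnd q Sq.
split=> //; rewrite ltn_neqAle leq_pq andbT.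
by apply: contraNneq pS => /val_inj ->.
Qed.

Lemma chain_fromW i k i' k' (S : {set 'I_n}) :
  i' <= i -> k' <= k -> chain_from i k S -> chain_from i' k' S.
Proof.
move=> lei lek [winc bnd]; split=> // p /bnd[h1 h2].
by split; [exact: leq_trans h1 | exact: leq_trans h2].
Qed.

(** The letter at [p] is itself the lower bound on the letters of [S], and [p] precedes every
    position of [S], so putting [p] in front keeps the order. *)
Lemma chain_from_cons (p : 'I_n) (S : {set 'I_n}) :
  chain_from (tnth w p) p.+1 S -> chain_from (tnth w p) p (p |: S).
Proof.
move=> [/weakly_increasingP winc bnd]; split.
  apply/weakly_increasingP => q r /setU1P[->|Sq] /setU1P[->|Sr] le_qr //.
  - by case: (bnd r Sr).
  - by case: (bnd q Sq) => _; rewrite ltnNge le_qr.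
  - exact: winc.
by move=> q /setU1P[-> //|/bnd[h1 /ltnW h2]].
Qed.

Lemma chain_from_behead i (p : 'I_n) (S : {set 'I_n}) :
  chain_from i p S -> chain_from i p.+1 (S :\ p).
Proof.
move=> [/weakly_increasingP winc bnd]; apply: chain_from_skip; last by rewrite setD11.
split; last by move=> q /setD1P[_]; exact: bnd.
apply/weakly_increasingP => q r /setD1P[_ Sq] /setD1P[_ Sr]; exact: winc.
Qed.

(** As [p] is the first position of [S], its letter is the least one used; once that letter exceeds
    [i], all of them do. *)
Lemma chain_from_raise i (p : 'I_n) (S : {set 'I_n}) :
  chain_from i p S -> p \in S -> tnth w p != i :> nat -> chain_from i.+1 p S.
Proof.
move=> [winc bnd] Sp neq; split=> // q Sq; have [_ le_pq] := bnd q Sq.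
split=> //; move/weakly_increasingP: winc => /(_ p q Sp Sq le_pq).
by apply: leq_trans; rewrite ltn_neqAle eq_sym neq; case: (bnd p Sp).
Qed.

Variable pi : array.
Hypothesis pi_bounded : bounded_pp m n pi.
Hypothesis Phi_pi : Phi m n pi = word_mx w.

Lemma row_count_word (a : 'I_m) (p : 'I_n) :
  row_count pi a p =
  (tnth w p == a) + maxn (row_count pi a p.+1) (row_count pi a.+1 p).
Proof. by case: pi_bounded => pp _ _; rewrite (row_count_rec a p pp) Phi_pi mxE. Qed.

(** Induction on [(m - i) + (n - k)], which drops whenever [i] or [k] is raised. *)
Lemma chain_from_le_row_count i k (S : {set 'I_n}) :
  chain_from i k S -> #|S| <= row_count pi i k.
Proof.
have [d] := ubnP ((m - i) + (n - k)); elim: d i k S => // d IH i k S le_d chS.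
case: (boolP ((m <= i) || (n <= k))) => [out|].
  suff -> : S = set0 by rewrite cards0.
  apply/setP => p; rewrite inE; apply/negP => /chS.2 [].
  by have := ltn_ord p; have := ltn_ord (tnth w p); lia.
rewrite negb_or -!ltnNge => /andP[im kn].
have := row_count_word (Ordinal im) (Ordinal kn); set p := Ordinal kn => /= rc.
rewrite rc; have [pS|pS] := boolP (p \in S); last first.
  apply: leq_trans (leq_addl _ _); apply: leq_trans (leq_maxl _ _).
  by apply: IH; [lia | exact: (@chain_from_skip i p)].
(* If the letter at [p] is [i], the matrix entry 1 pays for removing [p] from [S]. *)
have [wp|wp] := eqVneq (tnth w p : nat) i.
  rewrite -val_eqE /= wp eqxx (cardsD1 p S) pS leq_add2l.
  apply: leq_trans (leq_maxl _ _).
  by apply: IH; [lia | exact: (@chain_from_behead i p)].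
apply: leq_trans (leq_addl _ _); apply: leq_trans (leq_maxr _ _).
by apply: IH; [lia | exact: (@chain_from_raise i p)].
Qed.

(** The upper bound is attained: the same induction builds an optimal chain from those for
    [(i, k.+1)] and [(i.+1, k)]. *)
Lemma row_count_chain_from i k :
  exists2 S : {set 'I_n}, chain_from i k S & #|S| = row_count pi i k.
Proof.
have [d] := ubnP ((m - i) + (n - k)); elim: d i k => // d IH i k le_d.
case: (boolP ((m <= i) || (n <= k))) => [out|].
  exists set0; last by rewrite cards0 (row_count_out _ _ _ _ _ pi_bounded out).
  by split=> [|p]; [apply/weakly_increasingP => p q | ]; rewrite inE.
rewrite negb_or -!ltnNge => /andP[im kn].
have := row_count_word (Ordinal im) (Ordinal kn); set p := Ordinal kn => /= rc.
have [|S1 ch1 card1] := IH i k.+1; first lia.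
have [|S2 ch2 card2] := IH i.+1 k; first lia.
have [wp|wp] := eqVneq (tnth w p : nat) i; last first.
  (* The matrix entry is 0 here, so the larger of the two chains already suffices. *)
  move: rc; rewrite -val_eqE /= (negbTE wp) add0n => ->.
  case: leqP => _; [exists S2 | exists S1] => //.
    exact: chain_fromW ch2.
  exact: chain_fromW ch1.
have pS2 : p \notin S2 by apply/negP => /ch2.2 []; rewrite wp ltnn.
(* All letters of [S2] exceed [i], so [S2] avoids [p] and is also a chain from [(i, k.+1)]. The
   maximum is thus the size of [S1], the chain that [p] can extend. *)
have /maxn_idPl le21 : row_count pi i.+1 k <= row_count pi i k.+1.
  rewrite -card2; apply: chain_from_le_row_count.
  by apply: (@chain_from_skip i p) => //; exact: chain_fromW ch2.
have pS1 : p \notin S1 by apply/negP => /ch1.2 []; rewrite ltnn.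
exists (p |: S1).
  by have := @chain_from_cons p S1; rewrite wp; apply.
by rewrite cardsU1 pS1 card1 rc le21 -val_eqE /= wp eqxx.
Qed.

Lemma L_row_count i : i <= m -> L w (m - i) = row_count pi i 0.
Proof.
(* Since [i <= m], the letter bound [m - (m - i)] in [L] is [i]. *)
move=> im; rewrite /L subKn //; apply/eqP; rewrite eqn_leq; apply/andP; split.
  apply/bigmax_leqP => S /andP[winc /forall_inP bnd].
  by apply: chain_from_le_row_count; split=> // p /bnd.
have [S [winc bnd] <-] := row_count_chain_from i 0.
apply: (leq_bigmax_cond (F := fun S : {set 'I_n} => #|S|)).
by rewrite winc; apply/forall_inP => p /bnd[].
Qed.

End Chains.

Theorem theorem7p6 (n m : nat) (n_gt0 : 0 < n) (m_gt0 : 0 < m)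
    (w : n.-tuple 'I_m) :
  forall i : nat,
    pp_shape (Phi_inv (word_mx w)) i = nth 0 [seq L w (m - k) | k <- iota 0 m] i.
Proof.
move=> i; have bounded := Phi_inv_bounded (word_mx w).
rewrite pp_shape_row_count; have [im|im] := ltnP i m.
  rewrite (nth_map 0) ?size_iota // nth_iota // add0n.
  by rewrite (L_row_count _ _ _ _ bounded (Phi_invK _) _ (ltnW im)).
(* From row [m] on, the default 0 of [nth] matches the empty rows. *)
by rewrite nth_default ?size_map ?size_iota // (row_count_out _ _ _ _ _ bounded) ?im.
Qed.
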